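(* There exist a sequence $(n_i)_{i=1}^{\infty}$ of positive integers and absolute constants $c>0$, $C>0$ such that, for each $i \geq 1$, there is a triangle-free graph $G_i$ on $n_i$ vertices which is $(p_i, \beta_i)$-jumbled with $p_i \geq c\, n_i^{-1/3}$ and $\beta_i \leq C\sqrt{p_i n_i}\,\log n_i$.
   Context: All graphs are finite and simple. For a graph $G$ and $X \subseteq V(G)$, $e(X)$ denotes the number of edges of $G$ with both endpoints in $X$. A graph $G$ is said to be $(p,\beta)$-jumbled if $\left|e(X) - p\binom{|X|}{2}\right| \leq \beta |X|$ for all $X \subseteq V(G)$. *)

(* Defs.v *)
From mathcomp Require Import all_boot.
From Stdlib Require Import Reals.

Set Implicit Arguments.
Unset Strict Implicit.
Unset Printing Implicit Defensive.

Definition simple_graph (n : nat) (g : rel 'I_n) : Prop :=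
  (forall x y, g x y = g y x) /\ (forall x, g x x = false).

Definition triangle_free (n : nat) (g : rel 'I_n) : Prop :=
  forall x y z, ~ [&& g x y, g y z & g x z].

Definition edges_in (n : nat) (g : rel 'I_n) (X : {set 'I_n}) : nat :=
  #|[set uv : 'I_n * 'I_n | [&& (uv.1 < uv.2)%N, uv.1 \in X, uv.2 \in X & g uv.1 uv.2]]|.

Definition jumbled (n : nat) (g : rel 'I_n) (p beta : R) : Prop :=
  forall X : {set 'I_n},
    (Rabs (INR (edges_in g X) - p * INR 'C(#|X|, 2)) <= beta * INR #|X|)%R.

(* Main.v *)
(** Let F be the field with q = 2^k elements, chi = (-1)^Tr a nontrivial additive
    character of F, and G the Cayley graph on F^3 with connection set
    S = {(d, d x, d x^2) : chi(d x^3) = -1}, so that d is never 0 on S.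
    If (d_i, d_i x_i, d_i x_i^2), i = 1, 2, 3, lie in S and sum to 0, the
    Vandermonde determinant forces two of the x_i, and hence all three, to
    coincide; then the product of the chi(d_i x_i^3) is chi(0) = 1, not -1.
    The eigenvalue of G at the character (a, b, c) is q/2 times the number of
    roots of a + b x + c x^2 minus the number of roots of
    a + b x + c x^2 + x^3, so it is q(q-1)/2 at the trivial character and at
    most 3q/2 in absolute value elsewhere. The expander mixing lemma then gives
    jumbledness with n = q^3, p = (q-1)/(2q^2) and beta = 2q, which is even
    better than required by a logarithmic factor. *)

Require Import Defs.
From mathcomp Require Import all_boot all_order all_algebra all_field.
From mathcomp Require Import ring zify.

Set Implicit Arguments.
Unset Strict Implicit.
Unset Printing Implicit Defensive.

Import Order.TTheory GRing.Theory Num.Theory.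

(** * Signs and root counts *)

Section Sign.
Local Open Scope ring_scope.

Definition sgn (b : bool) : int := (-1) ^+ b.

Lemma sgnD a b : sgn (a (+) b) = sgn a * sgn b.
Proof. exact: signr_addb. Qed.

(** The substitution [s] flips every sign, so the sum is its own negative. Character orthogonality
    follows by taking [s] to be a translation. *)
Lemma sgn_sum0 (T : finType) (s : T -> T) (f : T -> bool) :
  injective s -> (forall u, f (s u) = ~~ f u) -> \sum_u sgn (f u) = 0.
Proof.
move=> s_inj fs.
have E : \sum_u sgn (f u) = - \sum_u sgn (f u).
  rewrite -sumrN (reindex_inj s_inj) /=.
  by apply: eq_bigr => u _; rewrite fs -addTb sgnD mulN1r.
by lia.
Qed.

Lemma card_roots (F : finFieldType) (p : {poly F}) :
  p != 0 -> (#|[set x | root p x]| < size p)%N.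
Proof.
move=> p0; rewrite cardE; apply: max_poly_roots => //.
  by apply/allP => x; rewrite mem_enum inE.
exact: enum_uniq.
Qed.

End Sign.

(** * A nontrivial additive character in characteristic 2 *)

Section Trace.
Local Open Scope ring_scope.

(** The witness is the absolute trace, whose values 0 and 1 are read as booleans. *)
Lemma exists_additive_bool (k : nat) (F : finFieldType) :
  2%N \in [pchar F] -> #|F| = (2 ^ k.+1)%N ->
  exists t : F -> bool,
    (forall u v, t (u + v) = t u (+) t v) /\ exists u, t u.
Proof.
move=> char2 cardF.
pose Tr (u : F) := \sum_(i < k.+1) u ^+ (2 ^ i).
have pow2D (u v : F) i : (u + v) ^+ (2 ^ i) = u ^+ (2 ^ i) + v ^+ (2 ^ i).
  apply: exprDn_pchar; apply/pnatP; first by rewrite expn_gt0.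
  move=> p pr_p; rewrite Euclid_dvdX // dvdn_prime2 // => /andP[/eqP-> _].
  exact: char2.
have TrD u v : Tr (u + v) = Tr u + Tr v.
  by rewrite /Tr -big_split; apply: eq_bigr => i _; apply: pow2D.
have Tr01 u : (Tr u == 0) || (Tr u == 1).
  (* Squaring shifts the summands cyclically, since [u ^+ #|F|] is [u]. *)
  have Trsq : Tr u ^+ 2 = Tr u.
    have -> : Tr u ^+ 2 = \sum_(i < k.+1) u ^+ (2 ^ i.+1).
      rewrite /Tr (big_morph (fun x => x ^+ 2) (fun x y => pow2D x y 1%N) (expr0n _ 2)).
      by apply: eq_bigr => i _; rewrite -exprM expnSr.
    by rewrite big_ord_recr -cardF expf_card /Tr big_ord_recl /= expr1 addrC.
  have : Tr u * (Tr u - 1) == 0 by rewrite mulrBr mulr1 -expr2 Trsq subrr.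
  by rewrite mulf_eq0 subr_eq0.
exists (fun u => Tr u != 0); split.
  move=> u v; rewrite TrD.
  by case/orP: (Tr01 u) => /eqP->; case/orP: (Tr01 v) => /eqP->;
    rewrite ?(addr0, add0r) ?addrr_pchar2 ?eqxx ?oner_eq0.
apply/existsP; rewrite -[[exists _, _]]negbK negb_exists; apply/negP=> /forallP Tr0.
(* If the trace vanished everywhere, this polynomial of degree [2 ^ k] would have [2 ^ k.+1]
   roots. *)
pose P : {poly F} := \sum_(i < k.+1) 'X^(2 ^ i).
have szP : size P = (2 ^ k).+1.
  rewrite /P big_ord_recr /= addrC size_polyDl size_polyXn //.
  apply: (big_ind (fun p : {poly F} => (size p < (2 ^ k).+1)%N)).
  - by rewrite size_poly0.
  - move=> p q sp sq; apply: leq_ltn_trans (size_polyD _ _) _.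
    by rewrite gtn_max sp sq.
  by move=> i _; rewrite size_polyXn ltnS ltn_exp2l.
have P0 : P != 0 by rewrite -size_poly_eq0 szP.
have := card_roots P0; rewrite szP.
have -> : [set x | root P x] = setT.
  apply/setP=> x; rewrite !inE /root horner_sum.
  under eq_bigr do rewrite hornerXn.
  by move: (Tr0 x); rewrite negbK.
by rewrite cardsT cardF ltnS leq_exp2l // ltnn.
Qed.

End Trace.

(** * The Cayley graph and its lack of triangles *)

Section Graph.
Local Open Scope ring_scope.

Variables (F : finFieldType) (t : F -> bool).
Hypothesis char2 : 2%N \in [pchar F].
Hypothesis tD : forall u v, t (u + v) = t u (+) t v.
Hypothesis t_nontriv : exists u, t u.

Local Notation V := (F * F * F)%type.
Local Notation q := #|F|.

Definition conn (w : V) : bool :=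
  [exists x, [&& w.1.2 == w.1.1 * x, w.2 == w.1.1 * x ^+ 2 & t (w.1.1 * x ^+ 3)]].

Lemma connP w :
  reflect (exists x, [/\ w.1.2 = w.1.1 * x, w.2 = w.1.1 * x ^+ 2 & t (w.1.1 * x ^+ 3)])
    (conn w).
Proof.
apply: (iffP existsP) => -[x]; first by case/and3P=> /eqP ? /eqP ? ?; exists x.
by case=> wx wxx tx; exists x; rewrite tx -wx -wxx !eqxx.
Qed.

(** In characteristic 2 the sum is also the difference. *)
Definition cayley (P Q : V) : bool := conn (P + Q).

Definition dot (P Q : V) : F := P.1.1 * Q.1.1 + P.1.2 * Q.1.2 + P.2 * Q.2.

Lemma t0 : t 0 = false.
Proof. by have := tD 0 0; rewrite addr0; case: (t 0). Qed.

Lemma cayley_sym P Q : cayley P Q = cayley Q P.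
Proof. by rewrite /cayley addrC. Qed.

Lemma addVV (P : V) : P + P = 0.
Proof. by case: P => [[a b] c]; congr (_, _, _); rewrite addrr_pchar2. Qed.

Lemma cayley_irr P : cayley P P = false.
Proof.
rewrite /cayley addVV; apply/negbTE/negP=> /connP[x [_ _]].
by rewrite /= mul0r t0.
Qed.

Lemma cayley_triangle_free P Q T :
  ~ [&& cayley P Q, cayley Q T & cayley P T].
Proof.
rewrite /cayley.
have -> : P + T = (P + Q) + (Q + T) by rewrite addrACA addrA -(addrA P) addVV addr0.
move: (P + Q) (Q + T) => [[a b] c] [[d e] f].
case/and3P=> /connP[x [/= -> -> tx]] /connP[y [/= -> -> ty]] /connP[z [/= E1 E2 tz]].
have a0 : a != 0 by apply: contraTneq tx => ->; rewrite mul0r t0.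
have d0 : d != 0 by apply: contraTneq ty => ->; rewrite mul0r t0.
have H1 : a * (x - z) = - (d * (y - z)).
  by apply/eqP; rewrite -subr_eq0; move/eqP: E1; rewrite -subr_eq0;
     congr (_ == 0); ring.
have H2 : a * (x - z) * (x + z) = - (d * (y - z) * (y + z)).
  by apply/eqP; rewrite -subr_eq0; move/eqP: E2; rewrite -subr_eq0;
     congr (_ == 0); ring.
(* Eliminate [a]: multiply [H1] by [x + z] and subtract [H2]. *)
have H3 : d * (y - z) * (x - y) = 0.
  have -> : d * (y - z) * (x - y) =
      (a * (x - z) + d * (y - z)) * (x + z) - (a * (x - z) * (x + z) + d * (y - z) * (y + z)) by ring.
  by rewrite H2 addNr H1 addNr mul0r subrr.
have yz_xz : y = z -> x = z.
  move=> yz; move/eqP: H1; rewrite yz subrr mulr0 oppr0 mulf_eq0 (negPf a0) subr_eq0.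
  by move/eqP.
have [yz xz] : y = z /\ x = z.
  move/eqP: H3; rewrite !mulf_eq0 (negPf d0) !subr_eq0 /= => /orP[/eqP yz|/eqP xy].
    by split=> //; apply: yz_xz.
  (* If [x = y] but [y != z], then [H1] forces [a = - d], so the third coefficient [a + d] is 0,
     against [tz]. *)
  suff : y = z by move=> yz; split=> //; apply: yz_xz.
  apply/eqP; rewrite -subr_eq0; apply/negPn/negP=> yz0.
  move: H1; rewrite xy -mulNr => /(mulIf yz0) ad.
  by rewrite ad addNr mul0r t0 in tz.
by move: tz; rewrite mulrDl tD -{1}xz tx -yz ty.
Qed.

(** * Characters and eigenvalues *)

Lemma dotDl P Q T : dot (P + Q) T = dot P T + dot Q T.
Proof. rewrite /dot /=; ring. Qed.

Lemma dotDr P Q T : dot T (P + Q) = dot T P + dot T Q.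
Proof. rewrite /dot /=; ring. Qed.

Lemma sum_sgn_mul u : \sum_(d : F) sgn (t (d * u)) = if u == 0 then q%:Z else 0.
Proof.
case: eqP => [->|/eqP u0].
  under eq_bigr do rewrite mulr0 t0.
  by rewrite sumr_const -[LHS]/(1 *+ #|F|) natz.
case: t_nontriv => v tv; apply: (sgn_sum0 (addrI (v / u))) => d.
by rewrite mulrDl tD mulfVK // tv.
Qed.

Lemma sum_sgn_dot w :
  \sum_(th : V) sgn (t (dot th w)) = if w == 0 then (q ^ 3)%:Z else 0.
Proof.
case: eqP => [->|/eqP w0].
  under eq_bigr do rewrite /dot /= !mulr0 !addr0 t0.
  by rewrite sumr_const -[LHS]/(1 *+ #|{: V}|) natz !card_prod expnSr expnSr expn1.
(* Translation by such a [th0] flips all signs; one supported on a nonzero coordinate of [w] will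
   do. *)
suff [th0 tth0] : exists th0, t (dot th0 w).
  by apply: (sgn_sum0 (addrI th0)) => th; rewrite dotDl tD tth0.
case: t_nontriv => v tv; case: w w0 => [[a b] c] w0; rewrite /dot /=.
have [a0|a0] := eqVneq a 0; last first.
  by exists (v / a, 0, 0); rewrite /= !mul0r !addr0 mulfVK.
have [b0|b0] := eqVneq b 0; last first.
  by exists (0, v / b, 0); rewrite /= !mul0r add0r addr0 mulfVK.
have [c0|c0] := eqVneq c 0; last first.
  by exists (0, 0, v / c); rewrite /= !mul0r !add0r mulfVK.
by move: w0; rewrite a0 b0 c0 eqxx.
Qed.

Definition curve (d x : F) : V := (d, d * x, d * x ^+ 2).

(* Twice the Fourier transform of the indicator of [conn]. *)
Definition eig (th : V) : int :=
  \sum_d \sum_x sgn (t (dot th (curve d x))) * (1 - sgn (t (d * x ^+ 3))).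

(** Only [d = w.1.1] contributes, and a nonzero [d] determines [x]. At [d = 0] the second factor
    vanishes because [t 0] is false; where [t] holds it equals 2. *)
Lemma conn_sum w :
  \sum_d \sum_x (w == curve d x)%:Z * (1 - sgn (t (d * x ^+ 3))) = 2 * (conn w)%:Z.
Proof.
rewrite (bigD1 w.1.1) //= [X in _ + X]big1 ?addr0; last first.
  move=> d dw; rewrite big1 // => x _; case: eqP => [E|]; last by rewrite mul0r.
  by move: dw; rewrite E eqxx.
have [/connP[x [wx wxx tx]]|nc] := boolP (conn w).
  rewrite (bigD1 x) //= [X in _ + X]big1 ?addr0.
    have -> : w == curve w.1.1 x by rewrite /curve -wx -wxx -!surjective_pairing.
    by rewrite tx.
  move=> y yx; case: eqP => [E|]; last by rewrite mul0r.
  case/eqP: yx; apply: (@mulfI _ w.1.1).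
    by apply: contraTneq tx => ->; rewrite mul0r t0.
  by rewrite -wx {2}E.
rewrite mulr0 big1 // => x _; case: eqP => [E|]; last by rewrite mul0r.
suff /negPf-> : ~~ t (w.1.1 * x ^+ 3) by rewrite subrr mulr0.
apply: contra nc => tx; apply/connP; exists x; split=> //; first by rewrite {1}E.
by rewrite {1}E.
Qed.

Lemma addV_eq0 (P Q : V) : (P + Q == 0) = (P == Q).
Proof.
by rewrite -(addVV Q) (inj_eq (addIr Q)).
Qed.

(** After exchanging sums, orthogonality keeps only the pairs with [w + curve d x = 0], that is,
    [w = curve d x]. *)
Lemma fourier_inversion w :
  \sum_th eig th * sgn (t (dot th w)) = 2 * (q ^ 3)%:Z * (conn w)%:Z.
Proof.
under eq_bigr do rewrite /eig mulr_suml.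
rewrite exchange_big /=.
rewrite mulrAC -conn_sum mulr_suml; apply: eq_bigr => d _.
under eq_bigr do rewrite mulr_suml.
rewrite exchange_big mulr_suml; apply: eq_bigr => x _ /=.
transitivity ((\sum_th sgn (t (dot th (w + curve d x)))) * (1 - sgn (t (d * x ^+ 3)))).
  rewrite mulr_suml; apply: eq_bigr => th _.
  by rewrite dotDr tD sgnD; ring.
by rewrite sum_sgn_dot addV_eq0; case: eqP => _; rewrite ?mul1r ?mul0r // mulrC.
Qed.

(** For fixed [x] both signs are characters in [d], so each sum over [d] is [q] at a root and 0
    elsewhere. *)
Lemma eigE th :
  eig th = q%:Z * (#|[set x | root (Poly [:: th.1.1; th.1.2; th.2]) x]|%:Z
                 - #|[set x | root (Poly [:: th.1.1; th.1.2; th.2; 1]) x]|%:Z).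
Proof.
rewrite /eig exchange_big /= mulrBr.
transitivity (\sum_x (\sum_d sgn (t (d * (th.1.1 + th.1.2 * x + th.2 * x ^+ 2)))
   - \sum_d sgn (t (d * (th.1.1 + th.1.2 * x + th.2 * x ^+ 2 + x ^+ 3))))).
  apply: eq_bigr => x _; rewrite -sumrB; apply: eq_bigr => d _.
  rewrite mulrBr mulr1 -sgnD -tD /dot /curve /=.
  by congr (sgn (t _) - sgn (t _)); ring.
have card_sum (f : F -> F) (p : {poly F}) : (forall x, p.[x] = f x) ->
    \sum_x \sum_d sgn (t (d * f x)) = q%:Z * #|[set x | root p x]|%:Z.
  move=> pf; under eq_bigr do rewrite sum_sgn_mul.
  rewrite -big_mkcond /= sumr_const mulrC -mulr_natl natz.
  congr (Posz _ * _); apply: eq_card => x.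
  by rewrite !inE /root pf.
by rewrite sumrB; congr (_ - _); apply: card_sum => x; rewrite !horner_cons hornerC; ring.
Qed.

Lemma eig0 : eig 0 = q%:Z * (q%:Z - 1).
Proof.
rewrite eigE; congr (_ * (Posz _ - Posz _)).
  rewrite -cardsT; apply: eq_card => x.
  by rewrite !inE /root horner_Poly /= !(mul0r, addr0) eqxx.
rewrite -(cards1 (0 : F)); apply: eq_card => x.
by rewrite !inE /root horner_Poly /= !(mul0r, addr0, add0r) mul1r !mulf_eq0 !orbb.
Qed.

(** A nonzero quadratic has at most 2 roots and a monic cubic at most 3, so the difference lies
    between -3 and 2. *)
Lemma eig_bound th : th != 0 -> `|eig th| <= 3 * q%:Z.
Proof.
move=> th0; rewrite eigE.
set A := #|_|; set B := #|_|.
have A2 : (A <= 2)%N.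
  rewrite /A -ltnS; apply: leq_trans (card_roots _) (size_Poly _).
  apply: contra th0 => /eqP/polyP E.
  have := E 0%N; have := E 1%N; have := E 2%N; rewrite !coef_Poly !coef0 /=.
  by case: th {A B E} => [[a b] c] /= -> -> ->.
have B3 : (B <= 3)%N.
  rewrite /B -ltnS; apply: leq_trans (card_roots _) (size_Poly _).
  apply/negP => /eqP/polyP/(_ 3%N); rewrite coef_Poly coef0 /= => /eqP.
  by rewrite oner_eq0.
rewrite normrM mulrC; apply: ler_pM => //; lia.
Qed.

(** * Expander mixing *)

Section Mixing.
Variable X : {set V}.

Definition epairs := #|[set PQ : V * V | [&& PQ.1 \in X, PQ.2 \in X & cayley PQ.1 PQ.2]]|.

Local Notation hatX th := (\sum_(P in X) sgn (t (dot th P))).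

Lemma hatX2 th : hatX th ^+ 2 = \sum_(P in X) \sum_(Q in X) sgn (t (dot th (P + Q))).
Proof.
rewrite expr2 mulr_suml; apply: eq_bigr => P _; rewrite mulr_sumr.
by apply: eq_bigr => Q _; rewrite dotDr tD sgnD.
Qed.

Lemma parseval : \sum_th hatX th ^+ 2 = (q ^ 3)%:Z * #|X|%:Z.
Proof.
under eq_bigr do rewrite hatX2.
rewrite exchange_big /= mulrC -natz mulr_natl -sumr_const; apply: eq_bigr => P PX.
rewrite exchange_big /= (bigD1 P) //= [X in _ + X]big1 ?addr0.
  by rewrite sum_sgn_dot addVV eqxx.
by move=> Q /andP[_ QP]; rewrite sum_sgn_dot addV_eq0 eq_sym (negPf QP).
Qed.

Lemma epairs_spectral :
  \sum_th eig th * hatX th ^+ 2 = 2 * (q ^ 3)%:Z * epairs%:Z.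
Proof.
under eq_bigr do rewrite hatX2 mulr_sumr.
rewrite exchange_big /=.
have -> : epairs%:Z = \sum_(P in X) \sum_(Q in X) (conn (P + Q))%:Z.
  rewrite pair_big_dep /= /epairs -sum1dep_card -natz natr_sum big_mkcond /=.
  rewrite [RHS]big_mkcond; apply: eq_bigr => -[P Q] _ /=.
  by rewrite /cayley; case: (P \in X); case: (Q \in X); case: (conn _).
rewrite mulr_sumr; apply: eq_bigr => P _.
under eq_bigr do rewrite mulr_sumr.
rewrite exchange_big mulr_sumr; apply: eq_bigr => Q _.
exact: fourier_inversion.
Qed.

Lemma mixing :
  `|2 * q%:Z ^+ 2 * epairs%:Z - (q%:Z - 1) * #|X|%:Z ^+ 2| <= 3 * q%:Z ^+ 3 * #|X|%:Z.
Proof.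
have q0 : 0 < q%:Z by rewrite ltz_nat; apply/card_gt0P; exists 0.
have q3 : (q ^ 3)%:Z = q%:Z ^+ 3 by rewrite -[LHS]natz natrX natz.
have h0 : hatX 0 = #|X|%:Z.
  under eq_bigr do rewrite /dot /= !mul0r !addr0 t0.
  by rewrite sumr_const -[LHS]/(1 *+ #|X|) natz.
have := epairs_spectral; rewrite (bigD1 (0 : V)) //= h0 eig0 => E.
(* Scaling by [q] turns the deviation into the sum [r] over nontrivial characters. *)
rewrite -(ler_pM2l q0) -[X in X * `|_|](gtr0_norm q0) -normrM.
set r := \sum_(_ | _) _ in E.
have -> : q%:Z * (2 * q%:Z ^+ 2 * epairs%:Z - (q%:Z - 1) * #|X|%:Z ^+ 2) = r.
  by apply: (addrI (q%:Z * (q%:Z - 1) * #|X|%:Z ^+ 2)); rewrite E q3; ring.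
apply: le_trans (ler_norm_sum _ _ _) _.
apply: (@le_trans _ _ (\sum_th 3 * q%:Z * hatX th ^+ 2)).
  (* The nonnegative term at 0 is put back so that [parseval] applies. *)
  rewrite [leRHS](bigD1 (0 : V)) //= -[leLHS]add0r lerD //.
    by rewrite mulr_ge0 ?sqr_ge0 // mulr_ge0 // ltW.
  apply: ler_sum => th th0; rewrite normrM (ger0_norm (sqr_ge0 _)).
  by apply: ler_wpM2r; [exact: sqr_ge0 | exact: eig_bound].
rewrite -mulr_sumr parseval le_eqVlt; apply/orP; left; apply/eqP.
by rewrite q3; ring.
Qed.

End Mixing.
End Graph.


(** * Transfer to ordinals and edge counts *)

Lemma card_ordered_pairs (n : nat) (g : rel 'I_n) (X : {set 'I_n}) :
  simple_graph g ->
  #|[set uv : 'I_n * 'I_n | [&& uv.1 \in X, uv.2 \in X & g uv.1 uv.2]]| =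
  2 * edges_in g X.
Proof.
case=> gC gI; set A := [set _ | _].
rewrite -(cardsID [set uv : 'I_n * 'I_n | uv.1 < uv.2] A) mul2n -addnn.
congr (_ + _).
  by apply: eq_card => -[u v]; rewrite !inE andbC.
have swap_inj : injective (fun uv : 'I_n * 'I_n => (uv.2, uv.1)).
  by move=> [a b] [c d] [-> ->].
rewrite /edges_in -[RHS](card_imset _ swap_inj).
apply: eq_card => -[u v]; apply/idP/imsetP => [|[[u' v']]].
  rewrite !inE -leqNgt leq_eqVlt /= => /and4P[vu uX vX guv].
  exists (v, u) => //; rewrite !inE /= vX uX -gC guv !andbT.
  by case/orP: vu => // /eqP/val_inj vu; rewrite vu gI in guv.
rewrite !inE /= => /and4P[uv uX vX guv] [-> ->].
by rewrite -leqNgt ltnW //= uX vX gC guv.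
Qed.

Lemma exists_pseudorandom_graph (k : nat) (q := 2 ^ k.+1) :
  exists g : rel 'I_(q ^ 3), [/\ simple_graph g, triangle_free g &
    forall X : {set 'I_(q ^ 3)},
      4 * (q * q) * edges_in g X <= q.-1 * (#|X| * #|X|) + 3 * (q * q * q) * #|X| /\
      q.-1 * (#|X| * #|X|) <= 4 * (q * q) * edges_in g X + 3 * (q * q * q) * #|X|].
Proof.
have [F char2 cardF] := pPrimePowerField (isT : prime 2) (ltn0Sn k).
have [t [tD t_nontriv]] := exists_additive_bool char2 cardF.
have cardV : q ^ 3 = #|{: F * F * F}| by rewrite !card_prod cardF expnSr expnSr expn1.
pose f (i : 'I_(q ^ 3)) : F * F * F := enum_val (cast_ord cardV i).
have f_inj : injective f by move=> i j /enum_val_inj /cast_ord_inj.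
pose g : rel 'I_(q ^ 3) := fun u v => cayley t (f u) (f v).
have sg : simple_graph g.
  by split=> [u v|u]; [apply: cayley_sym | apply: cayley_irr].
exists g; split=> // [u v w|X]; first exact: cayley_triangle_free.
have E : epairs t (f @: X) = 2 * edges_in g X.
  rewrite -card_ordered_pairs //.
  have ff_inj : injective (fun uv => (f uv.1, f uv.2)).
    by move=> [a b] [c d] [/f_inj-> /f_inj->].
  rewrite -[RHS](card_imset _ ff_inj) /epairs; apply: eq_card => -[P Q].
  rewrite inE /=; apply/and3P/imsetP => [[/imsetP[u uX ->] /imsetP[v vX ->] c]|].
    by exists (u, v); rewrite // inE /= uX vX.
  move=> [[u v]]; rewrite !inE /= => /and3P[uX vX guv] [-> ->].
  by split; rewrite ?imset_f.
have := mixing char2 tD t_nontriv (f @: X).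
rewrite E card_imset // cardF -/q; have : 0 < q by rewrite expn_gt0.
(* Writing [q] as a successor removes the predecessor; the two inequalities are the two sides of the
   absolute value in [mixing]. *)
move: (edges_in g X) #|X| => e m; clear; case: q => // s _ /=.
split; nia.
Qed.

Lemma bin2_sqr m : 2 * 'C(m, 2) + m = m * m.
Proof. by elim: m => // m IH; rewrite binS bin1; lia. Qed.

(* Real estimates *)
From Stdlib Require Import Reals Lra.

Lemma density_deviation (q e m : nat) (Q := INR q) :
  (2 <= Q)%R ->
  4 * (q * q) * e <= q.-1 * (m * m) + 3 * (q * q * q) * m ->
  q.-1 * (m * m) <= 4 * (q * q) * e + 3 * (q * q * q) * m ->
  (Rabs (INR e - (Q - 1) / (2 * Q ^ 2) * INR 'C(m, 2)) <= 2 * Q * INR m)%R.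
Proof.
move=> Q2 H1 H2.
have E2 : (2 * INR 'C(m, 2) = INR m ^ 2 - INR m)%R.
  by have := congr1 INR (bin2_sqr m); rewrite plus_INR !mult_INR /=; lra.
have Q1 : INR q.-1 = (Q - 1)%R by move: Q2; rewrite /Q; case: (q) => [|r]; rewrite ?S_INR /=; lra.
have M0 := pos_INR m.
move: (le_INR _ _ (elimT ssrnat.leP H1)) (le_INR _ _ (elimT ssrnat.leP H2)).
rewrite !plus_INR !mult_INR Q1 -/Q /=.
move: (INR e) (INR m) (INR 'C(m, 2)) M0 E2 => E M B M0 E2 K1 K2.
have -> : B = ((M ^ 2 - M) / 2)%R by lra.
have -> : (E - (Q - 1) / (2 * Q ^ 2) * ((M ^ 2 - M) / 2) =
    (4 * Q ^ 2 * E - (Q - 1) * (M ^ 2 - M)) * / (4 * Q ^ 2))%R by field; lra.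
have -> : (2 * Q * M = 8 * Q ^ 3 * M * / (4 * Q ^ 2))%R by field; lra.
have S0 : (0 < / (4 * Q ^ 2))%R by apply: Rinv_0_lt_compat; nra.
rewrite Rabs_mult (Rabs_pos_eq (/ _)); last lra.
apply: Rmult_le_compat_r; first lra.
(* Passing from [M ^ 2] to [M ^ 2 - M] costs [(Q - 1) * M]; with the mixing error this is at most
   [4 * Q ^ 3 * M], within the allowed [8 * Q ^ 3 * M]. *)
have QM : ((Q - 1) * M <= Q ^ 3 * M)%R by apply: Rmult_le_compat_r => //; nra.
by apply: Rabs_le; split; nra.
Qed.

Theorem theorem1 :
  exists (n : nat -> nat) (c C : R),
    (0 < c)%R /\ (0 < C)%R /\
    (forall i : nat, (1 <= i)%N -> (0 < n i)%N) /\
    (forall i : nat, (1 <= i)%N -> (n i < n i.+1)%N) /\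
    forall i : nat, (1 <= i)%N ->
      exists (g : rel 'I_(n i)) (p beta : R),
        simple_graph g /\ triangle_free g /\ jumbled g p beta /\
        (p >= c * Rpower (INR (n i)) (- (1 / 3)))%R /\
        (beta <= C * sqrt (p * INR (n i)) * ln (INR (n i)))%R.
Proof.
exists (fun i => expn (expn 2 i) 3), (1 / 4)%R, 4%R.
split; first lra.
split; first lra.
split; first by move=> i _; rewrite !expn_gt0.
split; first by move=> i _; rewrite ltn_exp2r // ltn_exp2l.
case=> // k _; have [g [sg tg Hg]] := exists_pseudorandom_graph k.
move: g sg tg Hg; set q := expn 2 k.+1 => g sg tg Hg.
have q2 : leq 2 q by rewrite /q expnS leq_pmulr // expn_gt0.
have Q2 : (2 <= INR q)%R by have := le_INR 2 q (elimT ssrnat.leP q2); rewrite /=; lra.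
set Q := INR q in Q2.
have n3 : INR (expn q 3) = (Q ^ 3)%R by rewrite !expnS expn0 !mult_INR -/Q /=; lra.
exists g, ((Q - 1) / (2 * Q ^ 2))%R, (2 * Q)%R.
(* This is where [c = 1 / 4] comes from: [1 / Q] is the cube-root power of [n], and [Q >= 2] since
   [i >= 1]. *)
have p_ge : (1 / 4 * / Q <= (Q - 1) / (2 * Q ^ 2))%R.
  have -> : ((Q - 1) / (2 * Q ^ 2) = 1 / 4 * / Q + (Q - 2) / (4 * Q ^ 2))%R by field; lra.
  suff : (0 <= (Q - 2) / (4 * Q ^ 2))%R by lra.
  by apply: Rle_mult_inv_pos; nra.
split=> //; split=> //; split; last split.
- by move=> X; have [H1 H2] := Hg X; apply: density_deviation.
- rewrite n3 Rpower_Ropp -(Rpower_pow 3 Q); last lra.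
  rewrite Rpower_mult (_ : INR 3 * (1 / 3) = 1)%R; last by rewrite /=; field.
  by rewrite Rpower_1; lra.
rewrite n3.
(* Here [p * n = (Q - 1) * Q / 2], which is at least [Q ^ 2 / 4]. *)
have Hs : (Q / 2 <= sqrt ((Q - 1) / (2 * Q ^ 2) * Q ^ 3))%R.
  rewrite -{1}(sqrt_Rsqr (Q / 2)); last lra.
  apply: sqrt_le_1_alt; rewrite /Rsqr.
  have -> : ((Q - 1) / (2 * Q ^ 2) * Q ^ 3 = (Q - 1) * Q / 2)%R by field; lra.
  nra.
(* [Q ^ 3 >= 8] exceeds e. With [Hs], [C = 4] then covers [beta = 2 * Q]. *)
have Hl : (1 <= ln (Q ^ 3))%R.
  rewrite -{1}(ln_exp 1); apply: Rlt_le; apply: ln_increasing; first exact: exp_pos.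
  have := exp_le_3; nra.
nra.
Qed.
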